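(* Let $m\le n\le k$ be positive integers and let $A\in\mathbb{R}^{m\times k}$, $B\in\mathbb{R}^{k\times n}$ be nonzero matrices whose entries follow the same distribution, and put $C=AB\in\mathbb{R}^{m\times n}$. Let $\sigma_1$ and $\gamma_1$ be the largest singular values of $A$ and $B$, let $d_1,d_2\ge 2$ be integers (bit-widths), and let $$\lambda_1=\frac{2^{d_1-1}-1}{R_1},\qquad \lambda_2=\frac{2^{d_2-1}-1}{R_2},$$ where $R_1,R_2$ are the largest absolute values of the entries of $A$ and $B$ respectively. Let $\widetilde A$ and $\widetilde B$ be the quantized-then-dequantized versions of $A$ with parameter $\lambda_1$ and of $B$ with parameter $\lambda_2$ (defined in the context), and let $\widetilde C=\widetilde A\,\widetilde B$. Then $$\mathbb{E}\big(\|C-\widetilde C\|_F\big)\le k\left(\sigma_1\lambda_2^{-1}\sqrt{n}+\gamma_1\lambda_1^{-1}\sqrt{m}+\lambda_1^{-1}\lambda_2^{-1}\sqrt{mn}\right).$$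
   Context: $\|\cdot\|_F$ is the Frobenius norm. Quantization with parameter $\lambda>0$ maps each real entry $a$ to the integer $q(a)=\mathrm{TypeCast}(\lambda a)$, where $\mathrm{TypeCast}$ is rounding of a real number to an integer with rounding error at most one, $|\mathrm{TypeCast}(x)-x|\le 1$ (for instance rounding down); dequantization maps the integer back to $q(a)/\lambda$. Thus the quantized-then-dequantized matrix $\widetilde A$ has entries $\widetilde a_{ij}=\mathrm{TypeCast}(\lambda a_{ij})/\lambda$. The expectation $\mathbb{E}$ is the mean over whatever randomness the rounding may have, for given $A$ and $B$ (it is trivial for a deterministic rounding); $\sigma_1,\gamma_1,\lambda_1,\lambda_2$ are the quantities of the given matrices $A,B$. *)

(* Defs.v *)
From HB Require Import structures.
From mathcomp Require Import all_boot all_order all_algebra.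
From mathcomp Require Import all_classical all_reals all_analysis.

Set Implicit Arguments.
Unset Strict Implicit.
Unset Printing Implicit Defensive.

Import Order.TTheory GRing.Theory Num.Theory.
Import numFieldNormedType.Exports.

Local Open Scope classical_set_scope.
Local Open Scope ring_scope.

(* The norm notation `|A| of MathComp-Analysis on matrices is the max norm,
   so the Frobenius norm is defined here. *)
Definition frobenius_norm (R : realType) (m n : nat) (A : 'M[R]_(m, n)) : R :=
  Num.sqrt (\sum_i \sum_j A i j ^+ 2).

Definition max_abs_entry (R : realType) (m n : nat) (A : 'M[R]_(m, n)) : R :=
  \big[Num.max/0]_i \big[Num.max/0]_j `|A i j|.

Definition singular_values (R : realType) (m n : nat) (A : 'M[R]_(m, n)) :
    set R :=
  [set Num.sqrt a | a in [set a | eigenvalue (A^T *m A) a]].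

(* The set of singular values is finite, and nonempty when 0 < n, so that its
   supremum is then its maximum. *)
Definition largest_singular_value (R : realType) (m n : nat)
    (A : 'M[R]_(m, n)) : R :=
  sup (singular_values A).

(* A possibly random rounding to an integer: [tc x w] is the rounding of [x]
   when the outcome of the rounding randomness is [w].  A deterministic rounding
   does not depend on [w].  MathComp-Analysis puts no sigma-algebra on [int];
   measurability for the discrete one amounts to measurability of the fibers. *)
Definition is_type_cast (R : realType) (d : measure_display)
    (T : measurableType d) (tc : R -> T -> int) : Prop :=
  (forall x z, measurable (tc x @^-1` [set z])) /\
  (forall x w, `|(tc x w)%:~R - x| <= 1).

(* Every entry has its own rounding function, so that the entries of a matrix
   may be rounded with different (for instance independent) randomness. *)
Definition quantize (R : realType) (T : Type) (m n : nat)
    (tc : 'I_m -> 'I_n -> R -> T -> int) (lambda : R) (A : 'M[R]_(m, n))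
    (w : T) : 'M[int]_(m, n) :=
  \matrix_(i, j) tc i j (lambda * A i j) w.

Definition dequantize (R : realType) (m n : nat) (lambda : R)
    (Q : 'M[int]_(m, n)) : 'M[R]_(m, n) :=
  \matrix_(i, j) ((Q i j)%:~R / lambda).

Definition quantization_parameter (R : realType) (m n : nat) (b : nat)
    (A : 'M[R]_(m, n)) : R :=
  (2 ^+ (b - 1) - 1) / max_abs_entry A.

(* All the entries of the random matrices [X] and [Y] follow one and the same
   distribution; no independence is required. *)
Definition entries_same_distribution (R : realType) (d : measure_display)
    (S : measurableType d) (P : probability S R) (m1 n1 m2 n2 : nat)
    (X : 'I_m1 -> 'I_n1 -> {RV P >-> R})
    (Y : 'I_m2 -> 'I_n2 -> {RV P >-> R}) : Prop :=
  exists mu : set R -> \bar R,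
    (forall i j, distribution P (X i j) = mu) /\
    (forall i j, distribution P (Y i j) = mu).

(* The matrix obtained for the outcome [s]. *)
Definition realization (R : realType) (d : measure_display)
    (S : measurableType d) (P : probability S R) (m n : nat)
    (X : 'I_m -> 'I_n -> {RV P >-> R}) (s : S) : 'M[R]_(m, n) :=
  \matrix_(i, j) X i j s.

(* Main.v *)
(* The bound holds for every outcome of the rounding. With E and F the rounding
   errors of A and B, whose entries are at most 1/lambda1 and 1/lambda2,
   AB - (A+E)(B+F) = -(AF + EB + EF). Here |AF|_F <= sigma1 |F|_F and
   |EB|_F <= gamma1 |E|_F, where |F|_F <= sqrt(kn)/lambda2 and
   |E|_F <= sqrt(mk)/lambda1, while the entries of EF are at most
   k/(lambda1 lambda2).
   That sigma1, the supremum of the square roots of the eigenvalues of A^T A,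
   bounds the operator norm of A is the variational characterization of the
   largest eigenvalue of a symmetric matrix M: the maximum mu of the quadratic
   form of M on the (compact) unit sphere makes mu I - M positive semidefinite
   and isotropic at the maximizer, which is therefore in its kernel. *)

Require Import Defs.
From mathcomp Require Import all_boot all_order all_algebra.
From mathcomp Require Import all_classical all_reals all_analysis.
From mathcomp Require Import ring lra.
Import Order.TTheory GRing.Theory Num.Theory.
Import numFieldNormedType.Exports.
Local Open Scope classical_set_scope.
Local Open Scope ring_scope.

(** * Cauchy-Schwarz and the Frobenius norm *)

Lemma Cauchy_Schwarz_sum (R : realType) (I : finType) (f g : I -> R) :
  (\sum_i f i * g i) ^+ 2 <= (\sum_i f i ^+ 2) * (\sum_i g i ^+ 2).
Proof.
(* Lagrange's identity: this double sum of squares is twice the difference of the two sides. *)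
have : 0 <= \sum_i \sum_j (f i * g j - f j * g i) ^+ 2.
  by apply: sumr_ge0 => i _; apply: sumr_ge0 => j _; exact: sqr_ge0.
have -> : \sum_i \sum_j (f i * g j - f j * g i) ^+ 2 =
    ((\sum_i f i ^+ 2) * (\sum_i g i ^+ 2) - (\sum_i f i * g i) ^+ 2) *+ 2.
  transitivity (\sum_i (f i ^+ 2 * (\sum_j g j ^+ 2) -
      f i * g i * (\sum_j f j * g j) *+ 2 + g i ^+ 2 * (\sum_j f j ^+ 2))).
    apply: eq_bigr => i _; rewrite !mulr_sumr -sumrMnl -sumrB -big_split/=.
    by apply: eq_bigr => j _; ring.
  by rewrite big_split/= sumrB sumrMnl -!mulr_suml; ring.
by rewrite pmulrn_lge0// subr_ge0.
Qed.

Section frobenius_norm.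
Context {R : realType}.

Lemma frobenius_norm_ge0 {m n} (A : 'M[R]_(m, n)) : 0 <= frobenius_norm A.
Proof. exact: sqrtr_ge0. Qed.

Lemma mxtrace_mulmx_tr {m n} (A B : 'M[R]_(m, n)) :
  \tr (A *m B^T) = \sum_i \sum_j A i j * B i j.
Proof.
by apply: eq_bigr => i _; rewrite mxE; apply: eq_bigr => j _; rewrite mxE.
Qed.

Lemma sqr_frobenius_norm {m n} (A : 'M[R]_(m, n)) :
  frobenius_norm A ^+ 2 = \tr (A *m A^T).
Proof.
rewrite mxtrace_mulmx_tr sqr_sqrtr//.
by apply: sumr_ge0 => i _; apply: sumr_ge0 => j _; exact: sqr_ge0.
Qed.

Lemma frobenius_normN {m n} (A : 'M[R]_(m, n)) :
  frobenius_norm (- A) = frobenius_norm A.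
Proof.
congr Num.sqrt; apply: eq_bigr => i _; apply: eq_bigr => j _.
by rewrite mxE sqrrN.
Qed.

Lemma frobenius_norm_tr {m n} (A : 'M[R]_(m, n)) :
  frobenius_norm A^T = frobenius_norm A.
Proof.
rewrite /frobenius_norm exchange_big/=; congr Num.sqrt.
by apply: eq_bigr => i _; apply: eq_bigr => j _; rewrite mxE.
Qed.

(** Cauchy-Schwarz for matrices seen as vectors indexed by pairs. Both the triangle inequality and
    the bound for right factors rest on it. *)
Lemma mxtrace_mulmx_tr_le {m n} (A B : 'M[R]_(m, n)) :
  \tr (A *m B^T) <= frobenius_norm A * frobenius_norm B.
Proof.
have := @Cauchy_Schwarz_sum R _ (fun p : 'I_m * 'I_n => A p.1 p.2)
  (fun p => B p.1 p.2).
rewrite -(pair_bigA _ (fun i j => A i j * B i j))/=.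
rewrite -(pair_bigA _ (fun i j => A i j ^+ 2))/=.
rewrite -(pair_bigA _ (fun i j => B i j ^+ 2))/=.
rewrite -!mxtrace_mulmx_tr -!sqr_frobenius_norm -exprMn => h.
apply: le_trans (ler_norm _) _.
rewrite -ler_sqr ?nnegrE ?mulr_ge0 ?frobenius_norm_ge0//.
by rewrite real_normK ?num_real.
Qed.

Lemma frobenius_normD {m n} (A B : 'M[R]_(m, n)) :
  frobenius_norm (A + B) <= frobenius_norm A + frobenius_norm B.
Proof.
rewrite -ler_sqr ?nnegrE ?addr_ge0 ?frobenius_norm_ge0//.
rewrite sqrrD !sqr_frobenius_norm linearD/= mulmxDl !mulmxDr !linearD/=.
have := mxtrace_mulmx_tr_le A B; have := mxtrace_mulmx_tr_le B A.
lra.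
Qed.

Lemma frobenius_norm_le_entries {m n} {A : 'M[R]_(m, n)} {c : R} :
  0 <= c -> (forall i j, `|A i j| <= c) ->
  frobenius_norm A <= c * Num.sqrt (m * n)%:R.
Proof.
move=> c0 Ac; rewrite -[leRHS]ger0_norm ?mulr_ge0 ?sqrtr_ge0//.
rewrite -sqrtr_sqr; apply: ler_wsqrtr; rewrite exprMn sqr_sqrtr ?ler0n//.
apply: (@le_trans _ _ (\sum_(i < m) \sum_(j < n) c ^+ 2)).
  apply: ler_sum => i _; apply: ler_sum => j _.
  by rewrite -real_normK ?num_real// lerXn2r ?nnegrE.
by rewrite !sumr_const !card_ord -mulrnA mulnC mulr_natr.
Qed.

End frobenius_norm.

(** * Quadratic forms and the largest eigenvalue of a symmetric matrix *)

Section rayleigh.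
Context {R : realType}.

Lemma mulmx_tr_row {n} (v : 'rV[R]_n) : (v *m v^T) 0 0 = \sum_i v 0 i ^+ 2.
Proof. by rewrite mxE; apply: eq_bigr => i _; rewrite mxE. Qed.

Lemma mulmx_tr_row_ge0 {n} (v : 'rV[R]_n) : 0 <= (v *m v^T) 0 0.
Proof. by rewrite mulmx_tr_row; apply: sumr_ge0 => i _; exact: sqr_ge0. Qed.

Lemma mulmx_tr_row_eq0 {n} (v : 'rV[R]_n) : (v *m v^T) 0 0 = 0 -> v = 0.
Proof.
rewrite mulmx_tr_row => /eqP.
rewrite psumr_eq0 => [/allP v0|i _]; last exact: sqr_ge0.
 apply/rowP => j; rewrite mxE; apply/eqP; rewrite -sqrf_eq0.
by apply: v0; rewrite mem_index_enum.
Qed.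

Lemma mulmx_tr_row_gt0 {n} {v : 'rV[R]_n} : v != 0 -> 0 < (v *m v^T) 0 0.
Proof.
move=> v0; rewrite lt0r mulmx_tr_row_ge0 andbT.
by apply: contra v0 => /eqP/mulmx_tr_row_eq0/eqP.
Qed.

(** Along the line [u + t *: w] with [w = u *m N], the form equals 2 t |w|^2 + t^2 c. It stays
    nonnegative for every t only if the linear coefficient vanishes, that is if w = 0. *)
Lemma psd_isotropic_kernel {n} (N : 'M[R]_n) (u : 'rV[R]_n) :
  N^T = N -> (forall v : 'rV_n, 0 <= (v *m N *m v^T) 0 0) ->
  (u *m N *m u^T) 0 0 = 0 -> u *m N = 0.
Proof.
move=> Nsym psd uu; pose w := u *m N.
pose b : R := (w *m w^T) 0 0; pose c : R := (w *m N *m w^T) 0 0.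
have c0 : 0 <= c by exact: psd.
have quad t : 0 <= t * b *+ 2 + t ^+ 2 * c.
  have -> : t * b *+ 2 + t ^+ 2 * c =
    ((u + t *: w) *m N *m (u + t *: w)^T) 0 0; last exact: psd.
  have wu : w *m N *m u^T = w *m w^T by rewrite {3}/w trmx_mul Nsym mulmxA.
  rewrite linearD linearZ /= !mulmxDl !mulmxDr -!scalemxAl -!scalemxAr wu.
  move: uu; rewrite -/w /b /c !mxE => ->; ring.
have b0 : b = 0.
  (* The minimizer would be - b / c; the added 1 covers c = 0 and still gives a value that is
     negative unless b = 0. *)
  have := quad (- b / (c + 1)).
  have c1 : c + 1 != 0 by rewrite gt_eqF// ltr_wpDl.
  have -> : - b / (c + 1) * b *+ 2 + (- b / (c + 1)) ^+ 2 * c =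
    - (b / (c + 1)) ^+ 2 * (c + 2) by field.
  rewrite mulNr oppr_ge0 pmulr_lle0 ?ltr_wpDl//.
  rewrite le_eqVlt sqrf_eq0 ltNge sqr_ge0 orbF.
  by rewrite mulf_eq0 invr_eq0 (negbTE c1) orbF => /eqP.
exact: mulmx_tr_row_eq0 b0.
Qed.

Lemma continuous_quadratic_form {n} (M : 'M[R]_n) :
  continuous (fun v : 'rV[R]_n => (v *m M *m v^T) 0 0).
Proof.
have -> : (fun v : 'rV[R]_n => (v *m M *m v^T) 0 0) =
    (fun v => \sum_i (\sum_j v 0 j * M j i) * v 0 i).
  apply/funext => v; rewrite mxE; apply: eq_bigr => i _.
  by rewrite !mxE.
have lin i : continuous (fun v : 'rV[R]_n => \sum_j v 0 j * M j i).
  apply: (continuous_big add_continuous) => j _ v.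
  by apply: continuousM; [exact: coord_continuous|exact: cst_continuous].
apply: (continuous_big add_continuous) => i _ v.
by apply: continuousM; [exact: lin|exact: coord_continuous].
Qed.

(** The dimension is [n.+1] so that the unit sphere, on which the form is maximized, is nonempty. *)
Lemma largest_eigenvalue_symmetric {n} {M : 'M[R]_n.+1} : M^T = M ->
  exists2 mu, eigenvalue M mu & forall v : 'rV[R]_n.+1,
    (v *m M *m v^T) 0 0 <= mu * (v *m v^T) 0 0.
Proof.
move=> Msym.
pose sphere := [set v : 'rV[R]_n.+1 | (v *m v^T) 0 0 = 1].
have sphere0 : sphere !=set0.
  exists (delta_mx 0 0); rewrite /sphere /= trmx_delta mul_delta_mx mxE.
  by rewrite !eqxx.
have sphere_compact : compact sphere.
  (* The sphere is closed, as the preimage of 1 under the form of the identity matrix, and lies in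
     the compact cube of entries in [-1, 1]. *)
  have box := @rV_compact R n.+1 (fun=> [set` `[(-1)%R, 1%R]])
    (fun=> @segment_compact _ _ _).
  apply: subclosed_compact box _.
    have /continuous_closedP := @continuous_quadratic_form n.+1 1%:M.
    move=> /(_ [set 1] (@closed_eq _ _)); congr closed.
    by apply/funext => v; rewrite /preimage /= mulmx1.
  move=> v; rewrite /sphere /= mulmx_tr_row => v1 i.
  rewrite in_itv/= -ler_norml.
  rewrite -(@expr_le1 _ 2)// real_normK ?num_real// -v1 (bigD1 i)//= lerDl.
  by apply: sumr_ge0 => j _; exact: sqr_ge0.
have [u /set_mem su umax] := EVT_max_rV sphere0 sphere_compact
  (continuous_subspaceT (@continuous_quadratic_form _ M)).
pose mu := (u *m M *m u^T) 0 0.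
have bound (v : 'rV[R]_n.+1) : (v *m M *m v^T) 0 0 <= mu * (v *m v^T) 0 0.
  have [->|v0] := eqVneq v 0; first by rewrite !mul0mx !mxE mulr0.
  have s0 := mulmx_tr_row_gt0 v0.
  set s := (v *m v^T) 0 0 in s0 *.
  (* Rescaling [v] to unit length divides both forms by [s]. *)
  pose a := (Num.sqrt s)^-1.
  have a2 : a * a = s^-1 by rewrite /a -expr2 exprVn sqr_sqrtr// ltW.
  have := umax (a *: v).
  rewrite linearZ /= -!scalemxAl -!scalemxAr !scalerA a2 -/mu.
  rewrite [X in X <= _]mxE mulrC ler_pdivrMr//; apply.
  rewrite inE /sphere /= linearZ /= -!scalemxAl -!scalemxAr !scalerA a2 mxE.
  by rewrite mulVf// gt_eqF.
exists mu => //; apply/eigenvalueP; exists u; last first.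
  apply/eqP => u0; move: su; rewrite /sphere /= u0 mul0mx mxE => /esym/eqP.
  by rewrite oner_eq0.
pose N := mu%:M - M.
have NE (v : 'rV[R]_n.+1) :
    (v *m N *m v^T) 0 0 = mu * (v *m v^T) 0 0 - (v *m M *m v^T) 0 0.
  by rewrite /N mulmxBr mulmxBl mul_mx_scalar -scalemxAl !mxE.
have : u *m N = 0.
  apply: psd_isotropic_kernel.
  - by rewrite /N linearB /= tr_scalar_mx Msym.
  - by move=> v; rewrite NE subr_ge0.
  - by rewrite NE [X in _ * X]su mulr1 subrr.
by rewrite /N mulmxBr mul_mx_scalar => /eqP; rewrite subr_eq0 => /eqP.
Qed.

End rayleigh.

(** * The largest singular value as an operator bound *)

Section largest_singular_value.
Context {R : realType}.

(** If the set has no supremum, for instance when it is empty, [sup] takes the default value 0;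
    otherwise it dominates some square root. *)
Lemma largest_singular_value_ge0 {m n} (A : 'M[R]_(m, n)) :
  0 <= largest_singular_value A.
Proof.
have [[[x Ex] ubE]|/sup_out] := pselect (has_sup (singular_values A)).
  apply: le_trans (ub_le_sup ubE Ex).
  by case: Ex => a _ <-; exact: sqrtr_ge0.
by rewrite /largest_singular_value => ->.
Qed.

Lemma quadratic_form_gram {m n} (A : 'M[R]_(m, n)) (v : 'rV[R]_n) :
  v *m (A^T *m A) *m v^T = (v *m A^T) *m (v *m A^T)^T.
Proof. by rewrite trmx_mul trmxK !mulmxA. Qed.

Lemma quadratic_form_gram_le {m n} (A : 'M[R]_(m, n)) (v : 'rV[R]_n) :
  (v *m (A^T *m A) *m v^T) 0 0 <=
    largest_singular_value A ^+ 2 * (v *m v^T) 0 0.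
Proof.
case: n A v => [A v|n A v].
  by rewrite (thinmx0 v) !mul0mx !mxE mulr0.
have Gsym : (A^T *m A)^T = A^T *m A by rewrite trmx_mul trmxK.
have [mu mu_eigen mu_max] := largest_eigenvalue_symmetric Gsym.
apply: le_trans (mu_max v) _; apply: ler_wpM2r; first exact: mulmx_tr_row_ge0.
(* Evaluating the maximality of [mu] at an eigenvector bounds every eigenvalue, so the singular
   values are bounded above and [sup] dominates the root of [mu]. *)
have le_mu a : eigenvalue (A^T *m A) a -> a <= mu.
  move=> /eigenvalueP[w wa w0].
  have ww := mulmx_tr_row_gt0 w0.
  have := mu_max w; rewrite wa -scalemxAl [X in X <= _]mxE.
  by rewrite ler_pM2r.
(* A Gram matrix has no negative eigenvalue, but the bound is immediate in that case too. *)
have [mu_ge0|mu_lt0] := leP 0 mu; last first.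
  by apply: le_trans (ltW mu_lt0) _; exact: sqr_ge0.
rewrite -{1}(sqr_sqrtr mu_ge0) lerXn2r ?nnegrE ?sqrtr_ge0//.
  exact: largest_singular_value_ge0.
apply: ub_le_sup; last by exists mu.
by exists (Num.sqrt mu) => _ [a /= /le_mu aM <-]; exact: ler_wsqrtr.
Qed.

(** The squared norm is the sum of the squared lengths of the columns, and each column of [E] is
    stretched by at most the largest singular value. Transposing turns the columns into rows. *)
Lemma frobenius_norm_mulmx_le {m n p} (A : 'M[R]_(m, n)) (E : 'M[R]_(n, p)) :
  frobenius_norm (A *m E) <= largest_singular_value A * frobenius_norm E.
Proof.
rewrite -ler_sqr ?nnegrE ?mulr_ge0 ?largest_singular_value_ge0
  ?frobenius_norm_ge0// exprMn.
rewrite -(frobenius_norm_tr (A *m E)) -(frobenius_norm_tr E).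
rewrite !sqr_frobenius_norm.
rewrite /mxtrace mulr_sumr; apply: ler_sum => j _.
have rowE k (B : 'M[R]_(p, k)) : (B *m B^T) j j = (row j B *m (row j B)^T) 0 0.
  by rewrite !mxE; apply: eq_bigr => i _; rewrite !mxE.
rewrite !rowE trmx_mul row_mul -quadratic_form_gram.
exact: quadratic_form_gram_le.
Qed.

(* [|EB|^2 = <E, (EB)B^T> <= |E| |B(EB)^T| <= |E| sigma_1(B) |EB|]: the right
   factor is bounded without knowing that [B] and [B^T] have the same
   singular values. *)
Lemma frobenius_norm_mulmxr_le {m n p} (E : 'M[R]_(m, n)) (B : 'M[R]_(n, p)) :
  frobenius_norm (E *m B) <= largest_singular_value B * frobenius_norm E.
Proof.
have [->|EB0] := eqVneq (frobenius_norm (E *m B)) 0.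
  by rewrite mulr_ge0 ?largest_singular_value_ge0 ?frobenius_norm_ge0.
have EB_gt0 : 0 < frobenius_norm (E *m B).
  by rewrite lt_def EB0 frobenius_norm_ge0.
rewrite -(ler_pM2r EB_gt0) -expr2 sqr_frobenius_norm.
rewrite -mulmxA -[B *m _]trmxK; apply: le_trans (mxtrace_mulmx_tr_le _ _) _.
rewrite mulrAC mulrC ler_wpM2r ?frobenius_norm_ge0// frobenius_norm_tr.
by rewrite -(frobenius_norm_tr (E *m B)); exact: frobenius_norm_mulmx_le.
Qed.

End largest_singular_value.

(** * Rounding errors and their effect on the product *)

Section quantization.
Context {R : realType}.

Lemma max_abs_entry_gt0 {m n} (A : 'M[R]_(m, n)) : A <> 0 ->
  0 < max_abs_entry A.
Proof.
move=> A0; rewrite ltNge; apply/negP => A_le0; apply: A0.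
apply/matrixP => i j; rewrite mxE; apply/eqP; rewrite -normr_le0.
apply: le_trans A_le0; rewrite /max_abs_entry.
apply: (bigmax_sup i) => //; exact: le_bigmax.
Qed.

(** With [2 <= b] the exponent [b - 1] is at least 1, which keeps the numerator positive. *)
Lemma quantization_parameter_gt0 {m n} (b : nat) (A : 'M[R]_(m, n)) :
  (2 <= b)%N -> A <> 0 -> 0 < quantization_parameter b A.
Proof.
move=> b2 A0; rewrite divr_gt0 ?max_abs_entry_gt0// subr_gt0.
by rewrite exprn_egt1 ?ltr1n// -lt0n subn_gt0.
Qed.

Lemma quantization_error_le {d} {T : measurableType d} {m n}
    (tc : 'I_m -> 'I_n -> R -> T -> int) (lambda : R) (A : 'M[R]_(m, n)) w :
  (forall i j, is_type_cast (tc i j)) -> 0 < lambda ->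
  forall i j,
    `|(dequantize lambda (quantize tc lambda A w) - A) i j| <= lambda^-1.
Proof.
move=> tc_cast lambda_gt0 i j; have [_ tc_err] := tc_cast i j.
have -> : (dequantize lambda (quantize tc lambda A w) - A) i j =
    ((tc i j (lambda * A i j) w)%:~R - lambda * A i j) / lambda.
  by rewrite !mxE; field; rewrite gt_eqF.
rewrite normrM [X in _ * X]gtr0_norm ?invr_gt0// -[leRHS]mul1r.
by rewrite ler_pM2r ?invr_gt0.
Qed.

Lemma frobenius_norm_product_error {m k n} (A At : 'M[R]_(m, k))
    (B Bt : 'M[R]_(k, n)) (a b : R) : 0 <= a -> 0 <= b ->
  (forall i j, `|(At - A) i j| <= a) -> (forall i j, `|(Bt - B) i j| <= b) ->
  frobenius_norm (A *m B - At *m Bt) <=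
    k%:R * (largest_singular_value A * b * Num.sqrt n%:R
            + largest_singular_value B * a * Num.sqrt m%:R
            + a * b * Num.sqrt (m * n)%:R).
Proof.
move=> a0 b0; set E := At - A; set F := Bt - B => Ea Fb.
have -> : A *m B - At *m Bt = - (A *m F + E *m B + E *m F).
  have AtE : At = A + E by rewrite /E addrC subrK.
  have BtE : Bt = B + F by rewrite /F addrC subrK.
  rewrite AtE BtE mulmxDl !mulmxDr.
  by rewrite -[A *m B + _ + _]addrA opprD addNKr addrA.
(* The norms of [E] and [F] only produce the square root of [k]; it is weakened to [k], the factor
   coming from the sums of [k] terms in [E *m F]. *)
have sqrt_le : Num.sqrt k%:R <= k%:R :> R.
  rewrite -[leRHS]ger0_norm// -sqrtr_sqr ler_wsqrtr// -natrX ler_nat.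
  by case: (k) => // k'; rewrite expnS expn1 leq_pmulr.
have FN : frobenius_norm F <= k%:R * (b * Num.sqrt n%:R).
  apply: le_trans (frobenius_norm_le_entries b0 Fb) _.
  by rewrite natrM sqrtrM// mulrCA ler_wpM2r// mulr_ge0.
have EN : frobenius_norm E <= k%:R * (a * Num.sqrt m%:R).
  apply: le_trans (frobenius_norm_le_entries a0 Ea) _.
  by rewrite mulnC natrM sqrtrM// mulrCA ler_wpM2r// mulr_ge0.
have EFN : frobenius_norm (E *m F) <= k%:R * (a * b * Num.sqrt (m * n)%:R).
  rewrite mulrA; apply: frobenius_norm_le_entries => [|i j].
    by rewrite !mulr_ge0.
  rewrite mxE; apply: le_trans (ler_norm_sum _ _ _) _.
  apply: (@le_trans _ _ (\sum_(l < k) a * b)).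
    by apply: ler_sum => l _; rewrite normrM ler_pM.
  by rewrite sumr_const card_ord mulr_natl.
rewrite frobenius_normN; apply: le_trans (frobenius_normD _ _) _.
rewrite !mulrDr; apply: lerD => //.
apply: le_trans (frobenius_normD _ _) _; apply: lerD.
- apply: le_trans (frobenius_norm_mulmx_le _ _) _.
  by rewrite -mulrA [leRHS]mulrCA ler_wpM2l// largest_singular_value_ge0.
- apply: le_trans (frobenius_norm_mulmxr_le _ _) _.
  by rewrite -mulrA [leRHS]mulrCA ler_wpM2l// largest_singular_value_ge0.
Qed.

End quantization.

(** * Expectation of a bounded function *)

Section expectation.
Import HBNNSimple.

(* The integral of a nonnegative function is a supremum over the simple
   functions below it, so no measurability is required. *)
Lemma expectation_le_cst {R : realType} {d} {T : measurableType d}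
    (P : probability T R) (X : T -> R) (c : R) :
  (forall w, 0 <= X w) -> (forall w, X w <= c) -> ('E_P[X] <= c%:E)%E.
Proof.
move=> X0 Xc; rewrite unlock ge0_integralTE; last by move=> w; rewrite lee_fin.
(* [T] is pointed, so some outcome forces [c] to be nonnegative; the constant [c] is then a
   nonnegative simple function. *)
have c0 : 0 <= c by rewrite (le_trans (X0 point))// Xc.
apply: ge_ereal_sup => _ [h /= hX <-].
have h_le_c : (sintegral P h <= sintegral P (cst_nnsfun T (NngNum c0)))%E.
  by apply: le_sintegral => w; rewrite (le_trans _ (Xc w))// -lee_fin.
apply: le_trans h_le_c _; rewrite -integralT_nnsfun.
rewrite [X in (X <= _)%E](_ : _ = \int[P]_w (cst c%:E w))%E//.
rewrite integral_cst//= [X in (_ * X)%E](_ : _ = 1%E) ?mule1//.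
exact: probability_setT.
Qed.

End expectation.

Theorem theorem4p3 (R : realType) (m n k : nat)
    (m_gt0 : (0 < m)%N) (le_mn : (m <= n)%N) (le_nk : (n <= k)%N)
    (* A and B are the given values of random matrices with identically
       distributed entries *)
    (dS : measure_display) (S : measurableType dS) (PS : probability S R)
    (X : 'I_m -> 'I_k -> {RV PS >-> R}) (Y : 'I_k -> 'I_n -> {RV PS >-> R})
    (XY_same : entries_same_distribution X Y)
    (s : S) (A : 'M[R]_(m, k)) (B : 'M[R]_(k, n))
    (A_def : A = realization X s) (B_def : B = realization Y s)
    (A_neq0 : A <> 0) (B_neq0 : B <> 0)
    (d1 d2 : nat) (d1_ge2 : (2 <= d1)%N) (d2_ge2 : (2 <= d2)%N)
    (* the randomness of the rounding, for given A and B *)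
    (dT : measure_display) (T : measurableType dT) (P : probability T R)
    (tcA : 'I_m -> 'I_k -> R -> T -> int) (tcB : 'I_k -> 'I_n -> R -> T -> int)
    (tcA_cast : forall i j, is_type_cast (tcA i j))
    (tcB_cast : forall i j, is_type_cast (tcB i j)) :
  let C := A *m B in
  let sigma1 := largest_singular_value A in
  let gamma1 := largest_singular_value B in
  let lambda1 := quantization_parameter d1 A in
  let lambda2 := quantization_parameter d2 B in
  let At := fun w => dequantize lambda1 (quantize tcA lambda1 A w) in
  let Bt := fun w => dequantize lambda2 (quantize tcB lambda2 B w) in
  let Ct := fun w => At w *m Bt w in
  ('E_P[fun w => frobenius_norm (C - Ct w)] <=
    (k%:R * (sigma1 * lambda2^-1 * Num.sqrt n%:R
             + gamma1 * lambda1^-1 * Num.sqrt m%:R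
             + lambda1^-1 * lambda2^-1 * Num.sqrt (m * n)%:R))%:E)%E.
Proof.
cbv zeta; set lambda1 := quantization_parameter d1 A.
set lambda2 := quantization_parameter d2 B.
have lambda1_gt0 : 0 < lambda1 by exact: quantization_parameter_gt0.
have lambda2_gt0 : 0 < lambda2 by exact: quantization_parameter_gt0.
apply: expectation_le_cst => w; first exact: frobenius_norm_ge0.
apply: frobenius_norm_product_error; rewrite ?invr_ge0 ?ltW//.
- exact: quantization_error_le.
- exact: quantization_error_le.
Qed.
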